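(* Let $a,n\in\mathbb{N}$ be such that $a\leq n$. The smallest $k\in\mathbb{N}$ such that there are $k$ subsets $B_1,\ldots,B_k$ of $[n]$ with the property that each element $i\in[n]$ is contained in an intersection $P=\bigcap_{j\in I}B_j$ of some of the $B_j$'s (with $I\subseteq\{1,\ldots,k\}$ nonempty, depending on $i$) with $|P|\leq a$, is equal to the smallest $k\in\mathbb{N}$ such that $$\left\lceil \frac{n}{\binom{k}{\lfloor k/2\rfloor}}\right\rceil\leq a.$$
   Context: $\mathbb{N}=\{1,2,\ldots\}$ and $[n]=\{1,\ldots,n\}$. The subsets $B_1,\ldots,B_k$ are not required to be distinct. *)

(* Defs.v *)
From mathcomp Require Import all_boot all_order all_algebra.

Set Implicit Arguments.
Unset Strict Implicit.
Unset Printing Implicit Defensive.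

Import Order.TTheory GRing.Theory Num.Theory.

(* The ground set [n] is rendered as 'I_n = {0, ..., n - 1}.  The family B may
   have repetitions. *)
Definition small_intersection_cover (n a k : nat) (B : 'I_k -> {set 'I_n}) :
    Prop :=
  forall i : 'I_n, exists I : {set 'I_k},
    [/\ I != set0, i \in \bigcap_(j in I) B j & #|\bigcap_(j in I) B j| <= a].

Definition has_small_intersection_cover (n a k : nat) : Prop :=
  exists B : 'I_k -> {set 'I_n}, small_intersection_cover a B.

(* The division and the ceiling are taken in the rationals. *)
Definition central_binomial_bound (n a k : nat) : Prop :=
  (Num.ceil (n%:R / 'C(k, k %/ 2)%:R : rat) <= a%:Z)%R.

(* Least among the positive integers: 0 is excluded. *)
Definition is_smallest_positive (P : nat -> Prop) (k : nat) : Prop :=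
  [/\ 0 < k, P k & forall m : nat, 0 < m -> P m -> k <= m].

(* Main.v *)
Require Import Defs.
From mathcomp Require Import all_boot all_order all_algebra.

(** Record a family [B_1, ..., B_k] by its incidence sets
    [f i = {j | i \in B_j}].  A point [i] lies in [\bigcap_(j in I) B_j] exactly
    when [I \subset f i], so the smallest intersection around [i] is
    [{i' | f i \subset f i'}], and the covering property says that every [f i]
    is nonempty and is contained in at most [a] of the sets [f i'].

    For [k > 0] such an [f] exists if and only if [n <= a * 'C(k, k %/ 2)].
    If it exists, then every chain of subsets of [[k]] meets the multiset of
    the [f i] at most [a] times, because the smallest member of the multiset on
    the chain is contained in all the others.  Averaging over maximal chains
    gives the multiset form [\sum_i 1 / 'C(k, #|f i|) <= a] of the LYM
    inequality ([lubell_yamamoto_meshalkin]), and the central binomial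
    coefficient is the largest one ([leq_bin_central]).  Conversely, one uses
    each of the subsets of size [k - k %/ 2] at most [a] times
    ([small_intersection_cover_of_bound]).  Thus both minima are the
    minimum of the same set of integers, which is nonempty because the
    singletons [B_j = {j}] give a covering family for [k = n]. *)

Set Implicit Arguments.
Unset Strict Implicit.
Unset Printing Implicit Defensive.

Import GRing.Theory Num.Theory.

Lemma factB (m p : nat) : p < m -> (m - p)`! = (m - p) * (m.-1 - p)`!.
Proof. by case: m => // m; rewrite ltnS => le_pm; rewrite subSn. Qed.

(** There are [#|S|`! * (#|A| - #|S|)`!] maximal chains of subsets of [A] that
    pass through [S], so the sum counts the pairs of a maximal chain and an
    index [i] whose set lies on it.  A maximal chain of [A] is one of
    [A :\ x], for some [x \in A], followed by [A]; hence the induction on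
    [#|A|].  Removing the indices with [f i = A] lowers the bound [b] by their
    number, which is what makes the induction go through. *)
Lemma lubell_yamamoto_meshalkin (J T : finType) (f : J -> {set T})
    (A : {set T}) (b : nat) :
  (forall i, f i \subset A ->
     #|[set j | (f i \subset f j) && (f j \subset A)]| <= b) ->
  \sum_(i | f i \subset A) #|f i|`! * (#|A| - #|f i|)`! <= b * #|A|`!.
Proof.
have [m] := ubnP #|A|; elim: m A b => // m IHm A b /ltnSE le_Am bound.
set w := #|[set j | f j == A]|.
have le_wb : w <= b.
  have [->//|] := posnP w; rewrite card_gt0 => /set0Pn[i].
  rewrite inE => /eqP fiA; apply: leq_trans (bound i _); last by rewrite fiA.
  by apply/subset_leq_card/subsetP => j; rewrite !inE fiA => /eqP->; rewrite subxx.
have split_top : \sum_(i | f i \subset A) #|f i|`! * (#|A| - #|f i|)`! =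
    w * #|A|`! + \sum_(x in A) \sum_(i | f i \subset A :\ x)
                   #|f i|`! * (#|A :\ x| - #|f i|)`!.
  rewrite (bigID (fun i => f i == A)) /=; congr (_ + _).
    rewrite (eq_bigr (fun=> #|A|`!)) => [|i /andP[_ /eqP->]]; last first.
      by rewrite subnn muln1.
    rewrite sum_nat_const; congr (_ * _); apply: eq_card => i.
    by rewrite !inE unfold_in /= andbC; case: eqP => // ->; rewrite subxx.
  rewrite (exchange_big_dep (fun i => (f i \subset A) && (f i != A))) /=;
    last first.
    move=> x i Ax fiAx; rewrite (subset_trans fiAx (subD1set _ _)) /=.
    by apply: contraTneq fiAx => ->; apply/subsetPn; exists x; rewrite ?inE ?eqxx.
  apply: eq_bigr => i /andP[fiA neq_fiA].
  have lt_fiA : #|f i| < #|A| by rewrite proper_card // properEneq neq_fiA.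
  rewrite (eq_bigr (fun=> #|f i|`! * (#|A|.-1 - #|f i|)`!)); last first.
    by move=> x /andP[Ax _]; rewrite (cardsD1 x A) Ax.
  rewrite sum_nat_const factB // mulnCA; congr (_ * _).
  rewrite -cardsDS //; apply: eq_card => x.
  by rewrite inE [RHS]unfold_in /= subsetD1 fiA andbC.
rewrite split_top.
have step x : x \in A ->
    \sum_(i | f i \subset A :\ x) #|f i|`! * (#|A :\ x| - #|f i|)`!
      <= (b - w) * (#|A|.-1)`!.
  move=> Ax; have cardAx : #|A :\ x| = #|A|.-1 by rewrite (cardsD1 x A) Ax.
  rewrite -[in leqRHS]cardAx; apply: IHm.
    by rewrite (leq_trans _ le_Am) // [in ltnRHS](cardsD1 x A) Ax.
  move=> i fiAx; have fiA := subset_trans fiAx (subD1set _ _).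
  have sub_top : [set j | f j == A] \subset
      [set j | (f i \subset f j) && (f j \subset A)].
    by apply/subsetP => j; rewrite !inE => /eqP->; rewrite fiA /=.
  rewrite leq_subRL // (leq_trans _ (bound i fiA)) //.
  rewrite -leq_subRL ?subset_leq_card // -cardsDS //.
  apply/subset_leq_card/subsetP => j.
  rewrite !inE => /andP[-> fjAx]; rewrite (subset_trans fjAx (subD1set _ _)).
  by rewrite !andbT; apply: contraTneq fjAx => ->; apply/subsetPn; exists x;
     rewrite ?inE ?eqxx.
apply: leq_trans (leq_add (leqnn _) (leq_sum _ step)) _.
rewrite sum_nat_const mulnCA.
have [A0|A_gt0] := posnP #|A|; first by rewrite A0 mul0n muln0 addn0 leq_mul.
by rewrite -[in #|A| * _](prednK A_gt0) -factS prednK // -mulnDl subnKC.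
Qed.

(** The ratio of ['C(k, p.+1)] to ['C(k, p)] is [(k - p) / p.+1], which is at
    least 1 for [p < k %/ 2]; the upper half follows by symmetry. *)
Lemma leq_bin_central (k m : nat) : 'C(k, m) <= 'C(k, k %/ 2).
Proof.
have incr p q : p <= q -> q <= k %/ 2 -> 'C(k, p) <= 'C(k, q).
  move=> /subnK<-; elim: (q - p) => // d IHd le_dk.
  apply: leq_trans (IHd (ltnW le_dk)) _.
  rewrite addSn -(leq_pmul2l (ltn0Sn (d + p))) mul_bin_left leq_mul2r.
  apply/orP; right; rewrite addSn in le_dk.
  have := leq_trunc_div k 2; move: le_dk; move: (k %/ 2) (d + p) => h s.
  move=> lt_sh le_hk; rewrite leq_subRL; last first.
    by apply: leq_trans le_hk; rewrite (leq_trans (ltnW lt_sh)) // leq_pmulr.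
  by apply: leq_trans le_hk; rewrite muln2 -addnn leq_add // ltnW.
have [le_mh|lt_hm] := leqP m (k %/ 2); first exact: incr.
have [le_mk|/bin_small->//] := leqP m k.
rewrite -bin_sub //; apply: incr => //.
have le_k : k <= k %/ 2 + (k %/ 2).+1.
  by rewrite addnS addnn -muln2 -addn1 {1}(divn_eq k 2) leq_add2l -ltnS ltn_mod.
by rewrite leq_subLR addnC (leq_trans le_k) // leq_add2l.
Qed.

(** The LYM inequality for the incidence sets: an intersection that contains [i]
    contains every point whose incidence set includes that of [i]. *)
Lemma bound_of_small_intersection_cover (n a k : nat) :
  has_small_intersection_cover n a k -> n <= a * 'C(k, k %/ 2).
Proof.
move=> [B coverB]; pose f i := [set j | i \in B j].
have lym : \sum_i #|f i|`! * (k - #|f i|)`! <= a * k`!.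
  have := @lubell_yamamoto_meshalkin _ _ f setT a.
  rewrite cardsT card_ord (eq_bigl xpredT) => [|i]; last exact: subsetT.
  apply=> i _; have [I [_ /bigcapP iI]] := coverB i.
  apply: leq_trans; apply/subset_leq_card/subsetP => j.
  rewrite !inE subsetT andbT => /subsetP fij; apply/bigcapP => l Il.
  by have := fij l; rewrite !inE; apply; apply: iI.
(* Each of the [n] summands [k`!] equals
   ['C(k, #|f i|) * (#|f i|`! * (k - #|f i|)`!)]. *)
rewrite -(leq_pmul2r (fact_gt0 k)) mulnAC.
apply: leq_trans (leq_mul lym (leqnn _)).
rewrite big_distrl -[n in n * _]card_ord -sum_nat_const leq_sum //= => i _.
have le_fik : #|f i| <= k by rewrite -[k in _ <= k]card_ord max_card.
by rewrite -(bin_fact le_fik) mulnC leq_mul2l leq_bin_central orbT.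
Qed.

(** Spread the points over the subsets of size [k - k %/ 2], point [i] going to
    the subset number [i %/ a]: these are incomparable, so only the points in
    the same block of [a] consecutive ones share a smallest intersection.  The
    upper of the two middle levels is used because its sets are nonempty also
    for [k = 1]. *)
Lemma small_intersection_cover_of_bound (n a k : nat) :
  0 < a -> 0 < k -> n <= a * 'C(k, k %/ 2) -> has_small_intersection_cover n a k.
Proof.
move=> a_gt0 k_gt0 le_n; pose m := k - k %/ 2.
pose L := [set S : {set 'I_k} | #|S| == m].
have cardL : #|L| = 'C(k, k %/ 2).
  by rewrite card_draws card_ord bin_sub // leq_div.
have lt_iL (i : 'I_n) : i %/ a < size (enum L).
  by rewrite -cardE cardL ltn_divLR // mulnC (leq_trans (ltn_ord i)).
pose f (i : 'I_n) := nth set0 (enum L) (i %/ a).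
have cardf i : #|f i| = m.
  by have := mem_nth set0 (lt_iL i); rewrite mem_enum inE => /eqP.
exists (fun j => [set i | j \in f i]) => i; exists (f i); split.
- by rewrite -card_gt0 cardf subn_gt0 ltn_Pdiv.
- by apply/bigcapP => j; rewrite inE.
have block j : j \in \bigcap_(l in f i) [set i' | l \in f i'] -> j %/ a = i %/ a.
  move=> /bigcapP fij; have /eqP : f i == f j.
    rewrite eqEcard !cardf leqnn andbT; apply/subsetP => l /fij.
    by rewrite inE.
  by move/eqP; rewrite /f nth_uniq ?enum_uniq // => /eqP.
rewrite -[a in _ <= a]card_ord.
apply: (@leq_card_in _ _ (fun j : 'I_n => Ordinal (ltn_pmod j a_gt0))).
move=> j1 j2 /block div1 /block div2 [eq_mod]; apply: val_inj => /=.
by rewrite (divn_eq j1 a) (divn_eq j2 a) div1 div2 eq_mod.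
Qed.

Lemma central_binomial_boundP (n a k : nat) :
  reflect (central_binomial_bound n a k) (n <= a * 'C(k, k %/ 2)).
Proof.
apply: (iffP idP); rewrite /central_binomial_bound ceil_le_int;
  rewrite ler_pdivrMr ?ltr0n ?bin_gt0 ?leq_div //;
  by rewrite -pmulrn -natrM ler_nat.
Qed.

Lemma singletons_small_intersection_cover (n a : nat) :
  0 < a -> has_small_intersection_cover n a n.
Proof.
move=> a_gt0; exists set1 => i; exists [set i].
by rewrite big_set1 cards1 set11 -card_gt0 cards1.
Qed.

Theorem theorem3p2 (a n : nat) (ha : 0 < a) (hn : 0 < n) (han : a <= n) :
  exists k : nat,
    is_smallest_positive (has_small_intersection_cover n a) k /\
    is_smallest_positive (central_binomial_bound n a) k.
Proof.
have ex_k : exists k, (0 < k) && (n <= a * 'C(k, k %/ 2)).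
  exists n; rewrite hn; apply: bound_of_small_intersection_cover.
  exact: singletons_small_intersection_cover.
case: (ex_minnP ex_k) => k /andP[k_gt0 le_n] min_k; exists k.
split; split=> //.
- exact: small_intersection_cover_of_bound.
- move=> m m_gt0 /bound_of_small_intersection_cover le_m.
  by apply: min_k; rewrite m_gt0.
- exact/central_binomial_boundP.
- by move=> m m_gt0 /central_binomial_boundP le_m; apply: min_k; rewrite m_gt0.
Qed.
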